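(* Let $X$ be a Banach space with an unconditional basis $(e_n)_{n=1}^\infty$. Then $X$ admits an equivalent norm $|\!|\!|\cdot|\!|\!|$ for which $(e_n)_{n=1}^\infty$ is $1$-unconditional and which has the following property: if $(x_n)_{n=1}^\infty \subset X$ is relatively weakly compact and satisfies $$\lim_{m,n\to\infty}\bigl[\,|\!|\!|x_m+x_n|\!|\!|^2 - 2\bigl(|\!|\!|x_m|\!|\!|^2+|\!|\!|x_n|\!|\!|^2\bigr)\bigr]=0,$$ then $(x_n)_{n=1}^\infty$ converges in norm. In particular, if $X$ is reflexive, then $|\!|\!|\cdot|\!|\!|$ is $2R$ and $(e_n)_{n=1}^\infty$ is $1$-unconditional for $|\!|\!|\cdot|\!|\!|$.
   Context: For $K\ge 1$, a basis $(e_n)$ is $K$-unconditional for a norm $\|\cdot\|$ if $\|\sum_n \pm a_n e_n\|\le K\|\sum_n a_n e_n\|$ for all scalars $(a_n)$ (such that $\sum_n a_ne_n$ converges) and all choices of signs; it is unconditional if it is $K$-unconditional for some $K$. A norm $\|\cdot\|$ on a Banach space $X$ is $2$-rotund ($2R$) if for every sequence $(x_n)\subset X$ with $\|x_n\|\le 1$ for all $n$ and $\lim_{m,n\to\infty}\|x_m+x_n\|=2$ there is $x\in X$ with $x_n\to x$ in norm. *)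

(* Defs.v *)
(* All Banach spaces are real. *)
From HB Require Import structures.
From mathcomp Require Import all_boot all_order all_algebra.
From mathcomp Require Import all_classical all_reals all_analysis.
Import Order.TTheory GRing.Theory Num.Theory.
Import numFieldNormedType.Exports.

Set Implicit Arguments.
Unset Strict Implicit.
Unset Printing Implicit Defensive.

Local Open Scope classical_set_scope.
Local Open Scope ring_scope.

Section norms.
Context {R : realType} {X : completeNormedModType R}.
Implicit Types (N : X -> R) (e u : nat -> X) (K : R).

(* Nonnegativity and N 0 = 0 follow from these three axioms. *)
Definition is_norm N : Prop :=
  [/\ forall x y, N (x + y) <= N x + N y,
      forall (a : R) x, N (a *: x) = `|a| * N x
    & forall x, N x = 0 -> x = 0].

Definition equivalent_norm N : Prop :=
  is_norm N /\
  exists c C : R,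
    [/\ 0 < c, 0 < C & forall x, c * `|x| <= N x /\ N x <= C * `|x| ].

Definition norm_cvg_to N u (l : X) : Prop :=
  N (u n - l) @[n --> \oo] --> (0 : R).

Definition norm_cvg N u : Prop := exists l, norm_cvg_to N u l.

Definition schauder_basis e : Prop :=
  forall x : X, exists! a : nat -> R,
    series (fun n => a n *: e n) @ \oo --> x.

(* The inequality | sum_n +-a_n e_n | <= K | sum_n a_n e_n | presupposes that
   the signed series converges; this is made explicit by the [exists2]. *)
Definition unconditional_for N K e : Prop :=
  forall (a : nat -> R) (s : nat -> bool) (x : X),
    norm_cvg_to N (series (fun n => a n *: e n)) x ->
    exists2 y : X,
      norm_cvg_to N (series (fun n => ((-1) ^+ s n * a n) *: e n)) y
      & N y <= K * N x.

Definition unconditional_basis e : Prop :=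
  schauder_basis e /\
  exists2 K : R, 1 <= K & unconditional_for (fun x => `|x|) K e.

Definition two_rotund N : Prop :=
  forall u : nat -> X,
    (forall n, N (u n) <= 1) ->
    N (u mn.1 + u mn.2) @[mn --> filter_prod \oo \oo] --> (2 : R) ->
    norm_cvg N u.

End norms.

Section duality.
Context {R : realType} (X : completeNormedModType R).

Definition dual : set (X -> R) := [set f : X -> R | scalar f /\ continuous f].

Definition dual_norm (f : X -> R) : R := sup [set `|f x| | x in [set x | `|x| <= 1]].

(* Elements of the bidual are represented by maps on all functions X -> R, of
   which only the restriction to [dual] matters. *)
Definition bidual (F : (X -> R) -> R) : Prop :=
  (forall (a : R) f g, dual f -> dual g ->
     F (fun x => a * f x + g x) = a * F f + F g) /\
  exists C : R, forall f, dual f -> `|F f| <= C * dual_norm f.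

Definition reflexive_space : Prop :=
  forall F, bidual F -> exists x : X, forall f, dual f -> F f = f x.

(* X with its weak topology, the coarsest one making all f in [dual]
   continuous. *)
Definition weak_space : topologicalType :=
  sup_topology (fun f : dual => Topological.on (initial_topology (\val f : X -> R))).

Definition relatively_weakly_compact (A : set X) : Prop :=
  precompact (A : set weak_space).

End duality.

(* Main.v *)
(* Call f : nat -> R a positive functional if f >= 0 and
   sum_j f_j |x_j| <= K^2 |x| for all x, where x_j are the coordinates of x. For
   each of the countably many finite families D of rational half-spaces
   { f : sum_j r_j f_j >= q }, let p_D(x) be the supremum of sum_j f_j |x_j| over
   the positive functionals f lying in all members of D. The p_D are lattice
   seminorms, and by Hahn-Banach the one with D empty is an equivalent norm.
   The new norm N is the weighted l^2 sum of all the p_D and all the coordinate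
   seminorms |x_j| |e_j|.

   If the parallelogram defect of N along (x_n) tends to 0, then so does that of
   each summand: the coordinates of x_n converge, p_D(x_n) converges to some L_D,
   and p_D(x_m + x_n) -> 2 L_D. For m, n large some f in D therefore satisfies
   f(|x_m|), f(|x_n|) ~ L_D. Adding to D a half-space expressing
   f(|x_m|) >= L_D - eps hence hardly decreases L_D, and the step can be iterated
   with infinitely many x_m. By compactness one positive functional f has
   f(|x_m|) >= L_D - eps along a whole subsequence. A suitable choice of signs
   turns f into g in X^* with g(x_m) ~ f(|x_m|), and evaluating g at a weak
   cluster point x gives L_D <= 3 p_D(x). Taking for D the constraint
   "f_j = 0 for j < k" and letting k -> oo, the tails of the x_n are uniformly
   small, so x_n -> x in norm. *)
Require Import Defs.
From HB Require Import structures.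
From mathcomp Require Import all_boot all_order all_algebra.
From mathcomp Require Import all_classical all_reals all_analysis.
From mathcomp Require Import ring lra.
Import Order.TTheory GRing.Theory Num.Theory.
Import numFieldNormedType.Exports.

Set Implicit Arguments.
Unset Strict Implicit.
Unset Printing Implicit Defensive.

Local Open Scope classical_set_scope.
Local Open Scope ring_scope.

(** * The Hahn-Banach theorem *)

Section hahn_banach.
Context (R : realType) (V : lmodType R).
Implicit Types (p q : V -> R) (x y v : V).

Definition sublinear p : Prop :=
  (forall x y, p (x + y) <= p x + p y) /\
  (forall (a : R) x, 0 <= a -> p (a *: x) = a * p x).

Lemma sublinear0 p : sublinear p -> p 0 = 0.
Proof. by move=> [_ pZ]; rewrite -(scale0r (0 : V)) pZ// mul0r. Qed.

Lemma sublinear_geN p x : sublinear p -> - p (- x) <= p x.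
Proof.
move=> sp; have [pD _] := sp.
by have := pD x (- x); rewrite subrr (sublinear0 sp); lra.
Qed.

(* The derivative of [p] at infinity in the direction [v]: a sublinear minorant
   of [p] which is linear on the line through [v]. *)
Definition directional p v x : R :=
  inf [set p (x + t *: v) - t * p v | t in [set t | 0 <= t]].

Lemma directional_le p v x (t : R) : sublinear p -> 0 <= t ->
  directional p v x <= p (x + t *: v) - t * p v.
Proof.
move=> sp t0; apply: ge_inf; last by exists t.
exists (- p (- x)) => _ [s /= s0 <-].
have [pD pZ] := sp; have := pD (x + s *: v) (- x).
by rewrite addrAC subrr add0r pZ//; lra.
Qed.

Lemma directional_ge p v x (c : R) :
  (forall t, 0 <= t -> c <= p (x + t *: v) - t * p v) -> c <= directional p v x.
Proof.
move=> h; apply: lb_le_inf; first by exists (p (x + 0 *: v) - 0 * p v), 0 => /=.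
by move=> _ [t /= t0 <-]; exact: h.
Qed.

Lemma directional_minorant p v x : sublinear p -> directional p v x <= p x.
Proof.
move=> sp; have := directional_le v x sp (lexx 0).
by rewrite scale0r addr0 mul0r subr0.
Qed.

Lemma directionalN p v : sublinear p -> directional p v (- v) <= - p v.
Proof.
move=> sp; apply: (le_trans (directional_le v (- v) sp ler01)).
by rewrite scale1r addNr (sublinear0 sp) mul1r sub0r.
Qed.

(** For subadditivity the parameters [s] and [t] of the two infima combine into [s + t]. For
    homogeneity, rescaling [t] to [a * t] gives one inequality, and the same inequality for [a^-1]
    gives the other. *)
Lemma sublinear_directional p v : sublinear p -> sublinear (directional p v).
Proof.
move=> sp; have [pD pZ] := sp; split.
  move=> x y; rewrite -lerBlDr; apply: directional_ge => s s0.
  rewrite lerBlDl -lerBlDr; apply: directional_ge => t t0.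
  rewrite lerBlDr; apply: (le_trans (directional_le (t := s + t) v (x + y) sp _)).
    exact: addr_ge0.
  have := pD (x + s *: v) (y + t *: v).
  by rewrite addrACA -scalerDl; lra.
have hle a x : 0 < a -> directional p v (a *: x) <= a * directional p v x.
  move=> a0; rewrite -ler_pdivrMl//; apply: directional_ge => t t0.
  rewrite ler_pdivrMl//; apply: (le_trans (directional_le (t := a * t) v _ sp _)).
    by rewrite mulr_ge0// ltW.
  by rewrite -scalerA -scalerDr pZ ?(ltW a0)// mulrBr mulrA.
move=> a x; rewrite le_eqVlt => /predU1P[<-|a0].
  rewrite scale0r mul0r; apply/eqP; rewrite eq_le; apply/andP; split.
    by apply: (le_trans (directional_minorant _ _ sp)); rewrite sublinear0.
  by apply: directional_ge => t t0; rewrite add0r pZ// subrr.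
apply/eqP; rewrite eq_le hle//= -ler_pdivlMl//.
have := hle a^-1 (a *: x); rewrite scalerA mulVf ?gt_eqF// scale1r.
by apply; rewrite invr_gt0.
Qed.

(* A minimal sublinear minorant of [p] coincides with its own directional
   derivatives, hence is odd, hence linear. *)
Lemma sublinear_minorant_linear p : sublinear p ->
  exists2 F : V -> R, scalar F & forall x, F x <= p x.
Proof.
move=> sp; pose T := {q : V -> R | sublinear q /\ forall x, q x <= p x}.
(* The order is reversed, so that a maximal element in Zorn's lemma is a minimal minorant. *)
pose r (s t : T) := `[< forall x, sval t x <= sval s x >].
have [||A Atot|] := @ZL_preorder T (exist _ p (conj sp (fun x => lexx (p x)))) r.
- by move=> t; apply/asboolP.
- move=> s t u /asboolP st /asboolP tu; apply/asboolP => x.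
  exact: le_trans (tu x) (st x).
- have [[t0 At0]|A0] := pselect (exists t, A t); last first.
    exists (exist _ p (conj sp (fun x => lexx (p x)))) => s As.
    by exfalso; apply: A0; exists s.
  pose q x := inf [set sval t x | t in A].
  have q_le t x : A t -> q x <= sval t x.
    move=> At; apply: ge_inf; last by exists t.
    exists (- p (- x)) => _ [s As <-].
    have [ss sle] := svalP s; have := sublinear_geN x ss.
    by have := sle (- x); lra.
  have q_ge x c : (forall t, A t -> c <= sval t x) -> c <= q x.
    move=> h; apply: lb_le_inf; first by exists (sval t0 x), t0.
    by move=> _ [t At <-]; exact: h.
  have sq : sublinear q.
    split=> [x y|a x a0].
      rewrite -lerBlDr; apply: (q_ge) => s As.
      rewrite lerBlDl -lerBlDr; apply: (q_ge) => t At; rewrite lerBlDr.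
      (* Members of a chain are comparable, and subadditivity of the smaller one bounds the infimum
         at [x + y]. *)
      have [/asboolP st|/asboolP ts] := Atot s t As At.
        apply: (le_trans (q_le t _ At)).
        have [[tD _] _] := svalP t; have := tD x y; have := st x; lra.
      apply: (le_trans (q_le s _ As)).
      have [[sD _] _] := svalP s; have := sD x y; have := ts y; lra.
    move: a0; rewrite le_eqVlt => /predU1P[<-|a0].
      rewrite scale0r mul0r; apply/eqP; rewrite eq_le; apply/andP; split.
        by apply: (le_trans (q_le t0 _ At0)); rewrite sublinear0//; case: (svalP t0).
      by apply: (q_ge) => t _; rewrite sublinear0//; case: (svalP t).
    apply/eqP; rewrite eq_le; apply/andP; split.
      rewrite -ler_pdivrMl//; apply: (q_ge) => t At; rewrite ler_pdivrMl//.
      by have [[_ tZ] _] := svalP t; rewrite -tZ ?(ltW a0)//; exact: q_le.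
    apply: (q_ge) => t At; have [[_ tZ] _] := svalP t; rewrite tZ ?(ltW a0)//.
    by rewrite ler_pM2l//; exact: q_le.
  have qp x : q x <= p x.
    by apply: (le_trans (q_le t0 x At0)); have [_] := svalP t0; exact.
  exists (exist _ q (conj sq qp)) => s As; apply/asboolP => x /=; exact: q_le.
- move=> [q [sq qp]] qmax.
  have qodd v : q (- v) = - q v.
    apply/eqP; rewrite eq_le; apply/andP; split; last first.
      by have := sublinear_geN v sq; lra.
    have dp x : directional q v x <= p x.
      exact: le_trans (directional_minorant v x sq) (qp x).
    pose t : T := exist _ _ (conj (sublinear_directional v sq) dp).
    have /asboolP/= h : r t (exist _ q (conj sq qp)).
      by apply: qmax; apply/asboolP => x /=; exact: directional_minorant.
    exact: le_trans (h _) (directionalN v sq).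
  exists q => //; have [qD qZ] := sq.
  have qadd x y : q (x + y) = q x + q y.
    apply/eqP; rewrite eq_le qD/=.
    have := qD (x + y) (- y); rewrite addrK qodd; lra.
  move=> a x y; rewrite qadd; congr (_ + _).
  have [a0|a0] := leP 0 a; first exact: qZ.
  rewrite (_ : a *: x = - (- a *: x)); last by rewrite scaleNr opprK.
  by rewrite qodd qZ ?oppr_ge0 ?(ltW a0)// mulNr opprK.
Qed.

(** A linear minorant [F] of the derivative in the direction [z] satisfies [F (- z) <= - p z], which
    is the missing inequality at [z]. *)
Lemma hahn_banach_norming p z : sublinear p ->
  exists F : V -> R, [/\ scalar F, forall x, F x <= p x & F z = p z].
Proof.
move=> sp.
have [F Flin Fle] := sublinear_minorant_linear (sublinear_directional z sp).
have Fp x : F x <= p x by apply: le_trans (Fle x) (directional_minorant z x sp).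
exists F; split=> //; apply/eqP; rewrite eq_le Fp/=.
have := le_trans (Fle (- z)) (directionalN z sp).
have := Flin (-1) z 0; have := Flin (-1) 0 0.
by rewrite scaler0 !addr0 scaleN1r; lra.
Qed.

End hahn_banach.

(** * Coordinates and positive functionals *)

Section unconditional_basis.
Context (R : realType) (X : completeNormedModType R) (e : nat -> X).
Implicit Types (x y z : X) (a b f : nat -> R).

Lemma norm_cvg_toP (u : nat -> X) x :
  norm_cvg_to (fun x => `|x|) u x <-> u @ \oo --> x.
Proof.
rewrite /norm_cvg_to; split.
  move=> /cvgr0Pnorm_lt h; apply/cvgrPdistC_lt => eps /h.
  by apply: filterS => n; rewrite normr_id.
move=> /cvgrPdistC_lt h; apply/cvgr0Pnorm_lt => eps /h.
by apply: filterS => n; rewrite normr_id.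
Qed.

Definition coef x : nat -> R :=
  xget (fun=> 0) [set a | series (fun n => a n *: e n) @ \oo --> x].

Context (basis_e : schauder_basis e).

Lemma coefP x : series (fun n => coef x n *: e n) @ \oo --> x.
Proof.
have [a [xa _]] := basis_e x.
by rewrite /coef; case: xgetP => [b _ //|/(_ a)].
Qed.

Lemma coef_unique a x : series (fun n => a n *: e n) @ \oo --> x -> coef x = a.
Proof.
move=> xa; have [b [_ ub]] := basis_e x.
by rewrite -(ub _ (@coefP x)); exact: ub.
Qed.

Lemma coef_inj x y : coef x =1 coef y -> x = y.
Proof.
move=> /funext xy; have := @coefP x; rewrite xy => h.
exact: (norm_cvg_unique h (@coefP y)).
Qed.

Lemma coefD x y n : coef (x + y) n = coef x n + coef y n.
Proof.
suff -> : coef (x + y) = (fun n => coef x n + coef y n) by [].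
apply: coef_unique.
rewrite (_ : series _ = series (fun n => coef x n *: e n) +
  series (fun n => coef y n *: e n)); first exact: (cvgD (@coefP x) (@coefP y)).
apply/funext => m.
rewrite [RHS]/GRing.add /= !seriesEnat /= -big_split /=.
by apply: eq_bigr => i _; rewrite scalerDl.
Qed.

Lemma coefZ c x n : coef (c *: x) n = c * coef x n.
Proof.
suff -> : coef (c *: x) = (fun n => c * coef x n) by [].
apply: coef_unique.
rewrite (_ : series _ = fun m => c *: series (fun n => coef x n *: e n) m).
  exact: (cvgZ (cvg_cst c) (@coefP x)).
apply/funext => m; rewrite !seriesEnat /= scaler_sumr.
by apply: eq_bigr => i _; rewrite scalerA.
Qed.

Lemma coefB x y n : coef (x - y) n = coef x n - coef y n.
Proof. by rewrite coefD -scaleN1r coefZ mulN1r. Qed.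

Lemma coef_sum a n j :
  coef (\sum_(0 <= i < n) a i *: e i) j = (j < n)%:R * a j.
Proof.
suff -> : coef (\sum_(0 <= i < n) a i *: e i) = (fun j => (j < n)%:R * a j) by [].
apply: coef_unique; apply: (@cvg_near_cst _ _ _ _ _ _).
exists n => // m /= nm; rewrite seriesEnat /= (big_cat_nat (leq0n n) nm)/=.
rewrite [X in _ + X]big_nat [X in _ + X]big1 ?addr0; last first.
  by move=> i /andP[ni _]; rewrite ltnNge ni mul0r scale0r.
by apply: eq_big_nat => i /andP[_ ->]; rewrite mul1r.
Qed.

Lemma basis_neq0 j : e j != 0.
Proof.
apply/eqP => ej0.
have := coef_sum (fun i => (i == j)%:R) j.+1 j.
rewrite big_nat_recr//= eqxx scale1r ej0 addr0 big_nat big1; last first.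
  by move=> i /andP[_ ij]; rewrite ltn_eqF// scale0r.
have := coefZ 0 0 j; rewrite scale0r mul0r => ->.
by rewrite ltnSn mulr1 => /eqP; rewrite eq_sym oner_eq0.
Qed.

Lemma coef_tail x (eps : R) : 0 < eps ->
  \forall n \near \oo, `|x - \sum_(0 <= j < n) coef x j *: e j| < eps.
Proof.
move=> eps0; have /cvgrPdist_lt/(_ _ eps0) := @coefP x.
by apply: filterS => n; rewrite seriesEnat.
Qed.

Context (K : R) (K1 : 1 <= K).
Context (uncond_e : unconditional_for (fun x => `|x|) K e).

Let K_ge0 : 0 <= K. Proof. exact: le_trans ler01 K1. Qed.

Lemma coef_signs (s : nat -> bool) x :
  exists2 y, coef y =1 (fun n => (-1) ^+ s n * coef x n) & `|y| <= K * `|x|.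
Proof.
have /norm_cvg_toP h := @coefP x.
have [y /norm_cvg_toP hy yx] := uncond_e s h.
by exists y => // n; rewrite (coef_unique hy).
Qed.

(** The projection onto the coordinates in [A] is the average of the identity and of the sign change
    outside [A]; its norm is at most [(1 + K) / 2 <= K]. *)
Lemma coef_proj (A : pred nat) x :
  exists2 y, coef y =1 (fun n => (A n)%:R * coef x n) & `|y| <= K * `|x|.
Proof.
have [z zx nz] := coef_signs (fun n => ~~ A n) x.
exists (2^-1 *: (x + z)) => [n|].
  by rewrite coefZ coefD zx; case: (A n) => /=; rewrite ?expr0 ?expr1; field.
rewrite normrZ ger0_norm ?invr_ge0// mulrC ler_pdivrMr//.
apply: (le_trans (ler_normD _ _)).
have := ler_wpM2r (normr_ge0 x) K1; rewrite mul1r; lra.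
Qed.

Lemma coef_bound x j : `|coef x j| * `|e j| <= K * `|x|.
Proof.
have [y hy yx] := coef_proj (pred1 j) x.
rewrite -normrZ; suff -> : coef x j *: e j = y by [].
apply: coef_inj => n; rewrite hy.
have := coef_sum (fun i => (i == j)%:R * coef x i) j.+1 n.
rewrite big_nat_recr//= eqxx mul1r big_nat big1; last first.
  by move=> i /andP[_ ij]; rewrite ltn_eqF// mul0r scale0r.
rewrite add0r => ->; rewrite ltnS; have [->|nj] := eqVneq n j.
  by rewrite leqnn mul1r.
by rewrite !mul0r mulr0.
Qed.

(* Nonnegative coefficient sequences representing positive functionals of
   norm at most [K ^+ 2]. *)
Definition posfun : set (nat -> R) := [set f | (forall j, 0 <= f j) /\
  forall x n, \sum_(0 <= j < n) f j * `|coef x j| <= K ^+ 2 * `|x| ].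

(** The witness is [|F (e j)|] for a Hahn-Banach functional [F] norming [x]. *)
Lemma posfun_norming x : exists2 f, posfun f & forall eps, 0 < eps ->
  exists n, `|x| - eps < \sum_(0 <= j < n) f j * `|coef x j|.
Proof.
have sub_norm : sublinear (fun x : X => `|x|).
  split; first exact: ler_normD.
  by move=> c y c0; rewrite normrZ ger0_norm.
have [F [Flin Fle Fx]] := hahn_banach_norming x sub_norm.
have F0 : F 0 = 0 by have := Flin (-1) 0 0; rewrite scaler0 addr0; lra.
have FD y z : F (y + z) = F y + F z by have := Flin 1 y z; rewrite scale1r mul1r.
have FZ c y : F (c *: y) = c * F y by have := Flin c y 0; rewrite F0 !addr0.
have Fsum n (b : nat -> R) :
    F (\sum_(0 <= j < n) b j *: e j) = \sum_(0 <= j < n) b j * F (e j).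
  elim: n => [|n IHn]; first by rewrite !big_geq.
  by rewrite !big_nat_recr//= FD FZ IHn.
have Fabs y : `|F y| <= `|y|.
  rewrite ler_norml Fle andbT lerNl.
  by have := Fle (- y); rewrite normrN -scaleN1r FZ mulN1r.
exists (fun j => `|F (e j)|).
  (* The sum is the value of [F] at a vector obtained from [y] by a sign change and a projection.
     Each costs a factor [K], whence the bound [K ^+ 2]. *)
  split=> // y n; pose s j := F (e j) * coef y j < 0.
  have [z zy nz] := coef_signs s y.
  have [w wz nw] := coef_proj (fun j => j < n)%N z.
  rewrite (_ : \sum_(_ <= _ < _) _ = F w).
    apply: (le_trans (Fle w)); apply: (le_trans nw); rewrite expr2 -mulrA.
    exact: ler_wpM2l.
  have -> : w = \sum_(0 <= j < n) ((-1) ^+ s j * coef y j) *: e j.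
    by apply: coef_inj => j; rewrite coef_sum wz zy.
  rewrite Fsum; apply: eq_bigr => j _; rewrite -normrM /s.
  have [h|h] := ltP; first by rewrite expr1 ltr0_norm//; ring.
  by rewrite expr0 ger0_norm//; ring.
move=> eps eps0; have [n _ /(_ n (leqnn n)) hn] := coef_tail x eps0.
exists n; set y := \sum_(_ <= _ < _) _ *: _ in hn.
have : `|x| - eps < F y.
  have := Fle (x - y); rewrite -Fx FD -scaleN1r FZ mulN1r scaleN1r; lra.
move=> /lt_le_trans; apply; rewrite /y Fsum; apply: ler_sum => j _.
by apply: (le_trans (ler_norm _)); rewrite normrM mulrC.
Qed.

End unconditional_basis.

(** * Weighted l2 sums of seminorms *)

Section l2_sum_of_seminorms.
Context (R : realType) (V : lmodType R) (q : nat -> V -> R) (B : V -> R).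
Implicit Types (x y : V).
Context (q_ge0 : forall i x, 0 <= q i x).
Context (qD : forall i x y, q i (x + y) <= q i x + q i y).
Context (qZ : forall i (a : R) x, q i (a *: x) = `|a| * q i x).
Context (qB : forall i x, q i x <= B x).

Let psum n x : R := \sum_(0 <= i < n) 2^-1 ^+ i.+1 * q i x ^+ 2.

Definition l2norm x : R := Num.sqrt (sup (range (psum ^~ x))).

Let w_gt0 i : 0 < 2^-1 ^+ i.+1 :> R.
Proof. by rewrite exprn_gt0// invr_gt0. Qed.

Let psum_bound n x : psum n x <= B x ^+ 2.
Proof.
(* The first [n] weights add up to [1 - 2^-1 ^+ n]. *)
have h : psum n x <= (1 - 2^-1 ^+ n) * B x ^+ 2.
  elim: n => [|n IHn]; first by rewrite /psum big_geq// expr0 subrr mul0r.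
  rewrite /psum big_nat_recr//= -/(psum n x).
  have : 2^-1 ^+ n.+1 * q n x ^+ 2 <= 2^-1 ^+ n.+1 * B x ^+ 2.
    rewrite ler_pM2l// lerXn2r// ?nnegrE//.
    exact: le_trans (q_ge0 n x) (qB n x).
  have e2 : 2^-1 ^+ n = 2 * 2^-1 ^+ n.+1 :> R by rewrite exprS; field.
  by move: IHn; rewrite e2; lra.
apply: (le_trans h); rewrite ler_piMl ?sqr_ge0// gerBl.
Qed.

Let has_sup_psum x : has_sup (range (psum ^~ x)).
Proof.
split; first by exists (psum 0 x), 0%N.
by exists (B x ^+ 2) => _ [n _ <-]; exact: psum_bound.
Qed.

Let psum_le n x : psum n x <= l2norm x ^+ 2.
Proof.
have h m : psum m x <= sup (range (psum ^~ x)).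
  by apply: ub_le_sup; [exact: (has_sup_psum x).2|exists m].
rewrite sqr_sqrtr//; apply: (le_trans _ (h 0%N)).
by rewrite /psum big_geq.
Qed.

Lemma l2norm_ge0 x : 0 <= l2norm x. Proof. exact: sqrtr_ge0. Qed.

Let l2norm_le x c : 0 <= c -> (forall n, psum n x <= c ^+ 2) -> l2norm x <= c.
Proof.
move=> c0 h; rewrite -(ler_pXn2r (n := 2)) ?nnegrE ?l2norm_ge0//.
rewrite sqr_sqrtr; last first.
  apply: (@le_trans _ _ (psum 0 x)); first by rewrite /psum big_geq.
  by apply: ub_le_sup; [exact: (has_sup_psum x).2|exists 0%N].
by apply: ge_sup => [|_ [n _ <-]]; [exact: (has_sup_psum x).1|exact: h].
Qed.

Lemma l2norm_le_bound x : l2norm x <= B x.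
Proof.
apply: l2norm_le => [|n]; last exact: psum_bound.
exact: le_trans (q_ge0 0%N x) (qB 0%N x).
Qed.

Lemma l2norm_ge i x : Num.sqrt (2^-1 ^+ i.+1) * q i x <= l2norm x.
Proof.
rewrite -(ler_pXn2r (n := 2)) ?nnegrE ?l2norm_ge0 ?mulr_ge0 ?sqrtr_ge0//.
rewrite exprMn sqr_sqrtr ?(ltW (w_gt0 i))//; apply: le_trans (psum_le i.+1 x).
rewrite /psum big_nat_recr//= lerDr; apply: sumr_ge0 => j _.
by rewrite mulr_ge0 ?sqr_ge0 ?(ltW (w_gt0 _)).
Qed.

Lemma l2normZ (a : R) x : l2norm (a *: x) = `|a| * l2norm x.
Proof.
have h c y : l2norm (c *: y) <= `|c| * l2norm y.
  apply: l2norm_le => [|n]; first by rewrite mulr_ge0 ?l2norm_ge0.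
  rewrite exprMn; apply: le_trans (ler_wpM2l (sqr_ge0 _) (psum_le n y)).
  rewrite /psum mulr_sumr; apply: ler_sum => i _.
  by rewrite qZ exprMn mulrCA.
apply/eqP; rewrite eq_le h/=.
have [->|a0] := eqVneq a 0; first by rewrite normr0 mul0r l2norm_ge0.
rewrite -ler_pdivlMl ?normr_gt0//.
by have := h a^-1 (a *: x); rewrite scalerA mulVf// scale1r normfV.
Qed.

(* Minkowski's inequality through
   [(u + v)^2 <= (1 + b/a) u^2 + (1 + a/b) v^2], with [a], [b] slightly larger
   than the two norms so that they are positive. *)
Lemma l2normD x y : l2norm (x + y) <= l2norm x + l2norm y.
Proof.
apply/ler_addgt0Pr => eps eps0; set a := l2norm x + eps / 2.
set b := l2norm y + eps / 2.
have a0 : 0 < a by rewrite ltr_wpDl ?l2norm_ge0 ?divr_gt0.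
have b0 : 0 < b by rewrite ltr_wpDl ?l2norm_ge0 ?divr_gt0.
suff : l2norm (x + y) <= a + b by rewrite /a /b; lra.
apply: l2norm_le => [|n]; first by rewrite addr_ge0// ltW.
have -> : (a + b) ^+ 2 = (1 + b / a) * a ^+ 2 + (1 + a / b) * b ^+ 2.
  by field; rewrite !gt_eqF.
have ba0 : 0 <= 1 + b / a by rewrite addr_ge0// divr_ge0// ltW.
have ab0 : 0 <= 1 + a / b by rewrite addr_ge0// divr_ge0// ltW.
have hx : psum n x <= a ^+ 2.
  apply: (le_trans (psum_le n x)).
  by rewrite lerXn2r ?nnegrE ?l2norm_ge0 ?(ltW a0)// /a lerDl divr_ge0// ltW.
have hy : psum n y <= b ^+ 2.
  apply: (le_trans (psum_le n y)).
  by rewrite lerXn2r ?nnegrE ?l2norm_ge0 ?(ltW b0)// /b lerDl divr_ge0// ltW.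
apply: le_trans (lerD (ler_wpM2l ba0 hx) (ler_wpM2l ab0 hy)).
rewrite /psum !mulr_sumr -big_split/=; apply: ler_sum => i _.
rewrite !(mulrCA _ (2^-1 ^+ _)) -mulrDr ler_pM2l//.
apply: (@le_trans _ _ ((q i x + q i y) ^+ 2)).
  by rewrite lerXn2r ?nnegrE ?addr_ge0.
rewrite -subr_ge0 (_ : _ - _ = (b * q i x - a * q i y) ^+ 2 / (a * b)).
  by rewrite divr_ge0 ?sqr_ge0// mulr_ge0// ltW.
by field; rewrite !gt_eqF.
Qed.

(** Every summand has a nonnegative defect, because [q j (x + y) ^+ 2 <= (q j x + q j y) ^+ 2];
    hence a single one is bounded by the total. *)
Lemma l2norm_defect i x y :
  2^-1 ^+ i.+1 * (2 * (q i x ^+ 2 + q i y ^+ 2) - q i (x + y) ^+ 2) <=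
  2 * (l2norm x ^+ 2 + l2norm y ^+ 2) - l2norm (x + y) ^+ 2.
Proof.
set d := fun j => 2^-1 ^+ j.+1 * (2 * (q j x ^+ 2 + q j y ^+ 2) - q j (x + y) ^+ 2).
have d0 j : 0 <= d j.
  rewrite mulr_ge0 ?(ltW (w_gt0 j))//.
  have h : q j (x + y) ^+ 2 <= (q j x + q j y) ^+ 2.
    by rewrite lerXn2r ?nnegrE ?addr_ge0.
  have := sqr_ge0 (q j x - q j y); move: h; rewrite !expr2; nra.
rewrite lerBrDr -lerBrDl -/(d i).
suff h n : psum n (x + y) <= 2 * (l2norm x ^+ 2 + l2norm y ^+ 2) - d i.
  rewrite {1}/l2norm sqr_sqrtr.
    by apply: ge_sup => [|_ [n _ <-]]; [exact: (has_sup_psum _).1|exact: h].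
  apply: (@le_trans _ _ (psum 0 (x + y))); first by rewrite /psum big_geq.
  by apply: ub_le_sup; [exact: (has_sup_psum _).2|exists 0%N].
have h m : psum m (x + y) = 2 * (psum m x + psum m y) - \sum_(0 <= j < m) d j.
  rewrite /psum mulrDr !mulr_sumr -big_split -sumrB/=; apply: eq_bigr => j _.
  by rewrite /d; ring.
(* The partial sum is lengthened so that it contains the index [i]. *)
have hm : psum n (x + y) <= psum (maxn n i.+1) (x + y).
  rewrite /psum (big_cat_nat (n := n) (p := maxn n i.+1)) ?leq_maxl//= lerDl.
  by apply: sumr_ge0 => j _; rewrite mulr_ge0 ?sqr_ge0 ?(ltW (w_gt0 _)).
apply: (le_trans hm); rewrite h.
have := psum_le (maxn n i.+1) x; have := psum_le (maxn n i.+1) y.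
suff : d i <= \sum_(0 <= j < maxn n i.+1) d j by lra.
rewrite (big_cat_nat (n := i.+1) (p := maxn n i.+1)) ?leq_maxr//= big_nat_recr//=.
by rewrite addrAC lerDr addr_ge0// sumr_ge0.
Qed.

End l2_sum_of_seminorms.

(** * Seminorms defined by rational cuts *)

Section cuts.
Context (R : realType) (X : completeNormedModType R) (e : nat -> X).
Implicit Types (x y z : X) (f : nat -> R) (D : seq (seq rat * rat)).
Context (K : R).

(** Finite rational data form a countable type, so that all finite families of half-spaces can be
    listed in one sequence of seminorms. *)
Definition half_space (rc : seq rat * rat) : set (nat -> R) :=
  [set f | ratr rc.2 <= \sum_(0 <= j < size rc.1) f j * ratr rc.1`_j].

Definition cut D : set (nat -> R) :=
  [set f | posfun e K f /\ forall rc, rc \in D -> half_space rc f].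

(** The supremum runs over partial sums, so no convergence has to be settled first; an empty cut
    gives [0]. *)
Definition cut_norm D x : R :=
  sup [set y | exists f n, cut D f /\ y = \sum_(0 <= j < n) f j * `|coef e x j|].

Lemma cut_norm_ge0 D x : 0 <= cut_norm D x.
Proof.
have [[f Df]|D0] := pselect (exists f, cut D f).
  apply: ub_le_sup; last by exists f, 0%N; rewrite big_geq.
  exists (K ^+ 2 * `|x|) => _ [g [n [[[_ gb] _] ->]]]; exact: gb.
rewrite /cut_norm (_ : [set _ | _] = set0) ?sup0//.
by apply/seteqP; split=> // y [f [n [Df _]]]; apply: D0; exists f.
Qed.

Lemma cut_norm_ge D f n x :
  cut D f -> \sum_(0 <= j < n) f j * `|coef e x j| <= cut_norm D x.
Proof.
move=> Df; apply: ub_le_sup; last by exists f, n.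
exists (K ^+ 2 * `|x|) => _ [g [m [[[_ gb] _] ->]]]; exact: gb.
Qed.

Lemma cut_norm_le D x c : 0 <= c ->
  (forall f n, cut D f -> \sum_(0 <= j < n) f j * `|coef e x j| <= c) ->
  cut_norm D x <= c.
Proof.
move=> c0 h; have [[f Df]|D0] := pselect (exists f, cut D f).
  apply: ge_sup; last by move=> _ [g [n [Dg ->]]]; exact: h.
  by exists (\sum_(0 <= j < 0) f j * `|coef e x j|), f, 0%N.
rewrite /cut_norm (_ : [set _ | _] = set0) ?sup0//.
by apply/seteqP; split=> // y [f [n [Df _]]]; apply: D0; exists f.
Qed.

Lemma cut_norm_gt D x c : 0 <= c -> c < cut_norm D x ->
  exists f n, cut D f /\ c < \sum_(0 <= j < n) f j * `|coef e x j|.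
Proof.
move=> c0 hc; apply: contrapT => h; move: hc; rewrite ltNge => /negP; apply.
apply: cut_norm_le => // f n Df; rewrite leNgt; apply/negP => hc.
by apply: h; exists f, n.
Qed.

Lemma cut_norm_abs D x y :
  (forall j, `|coef e x j| = `|coef e y j|) -> cut_norm D x = cut_norm D y.
Proof.
move=> xy; rewrite /cut_norm; congr sup; apply/seteqP; split=> _ [f [n [Df ->]]];
  by exists f, n; split=> //; apply: eq_bigr => j _; rewrite xy.
Qed.

Context (basis_e : schauder_basis e) (K1 : 1 <= K).
Context (uncond_e : unconditional_for (fun x => `|x|) K e).

Lemma posfun_coef_ge0 f : posfun e K f -> forall j x, 0 <= f j * `|coef e x j|.
Proof. by move=> [f0 _] j x; rewrite mulr_ge0. Qed.

Lemma cut_norm_bound D x : cut_norm D x <= K ^+ 2 * `|x|.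
Proof.
apply: cut_norm_le; first by rewrite mulr_ge0// sqr_ge0.
by move=> f n [[_ fb] _]; exact: fb.
Qed.

Lemma cut_normD D x y : cut_norm D (x + y) <= cut_norm D x + cut_norm D y.
Proof.
apply: cut_norm_le; first by rewrite addr_ge0// cut_norm_ge0.
move=> f n Df; apply: le_trans (lerD (cut_norm_ge n x Df) (cut_norm_ge n y Df)).
rewrite -big_split/=; apply: ler_sum => j _; rewrite -mulrDr coefD//.
by rewrite ler_wpM2l ?ler_normD//; have [[]] := Df.
Qed.

Lemma cut_normZ D (a : R) x : cut_norm D (a *: x) = `|a| * cut_norm D x.
Proof.
have h c y : cut_norm D (c *: y) <= `|c| * cut_norm D y.
  apply: cut_norm_le => [|f n Df]; first by rewrite mulr_ge0 ?cut_norm_ge0.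
  apply: le_trans (ler_wpM2l (normr_ge0 c) (cut_norm_ge n y Df)).
  rewrite mulr_sumr; apply: ler_sum => j _.
  by rewrite coefZ// normrM mulrCA.
apply/eqP; rewrite eq_le h/=.
have [->|a0] := eqVneq a 0; first by rewrite normr0 mul0r cut_norm_ge0.
rewrite -ler_pdivlMl ?normr_gt0//.
by have := h a^-1 (a *: x); rewrite scalerA mulVf// scale1r normfV.
Qed.

Lemma cut_norm_nil_ge x : `|x| <= cut_norm [::] x.
Proof.
apply/ler_addgt0Pr => eps eps0.
have [f pf /(_ _ eps0)[n hn]] := posfun_norming basis_e K1 uncond_e x.
have : cut [::] f by split.
by move=> /(cut_norm_ge n x); move: hn; lra.
Qed.

(** The defining bound is tested on [e j]. The resulting coordinatewise bound provides the
    compactness of the set of positive functionals. *)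
Lemma posfun_le f j : posfun e K f -> f j <= K ^+ 2 * `|e j|.
Proof.
move=> [f0 fb]; apply: le_trans (fb (e j) j.+1).
have cj i : coef e (e j) i = (i == j)%:R.
  have := coef_sum basis_e (fun i => (i == j)%:R) j.+1 i.
  rewrite big_nat_recr//= eqxx scale1r big_nat big1; last first.
    by move=> k /andP[_ kj]; rewrite ltn_eqF// scale0r.
  rewrite add0r => ->; rewrite ltnS; have [->|nj] := eqVneq i j.
    by rewrite leqnn mul1r.
  by rewrite mulr0.
rewrite big_nat_recr//= cj eqxx normr1 mulr1 lerDr sumr_ge0// => i _.
by rewrite mulr_ge0.
Qed.

(* The coefficient functionals below [k] are killed by the half-space
   [- \sum_(j < k) f j >= 0]. *)
Definition tail_cut k : seq (seq rat * rat) := [:: (nseq k (-1), 0)].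

Lemma tail_cutP k f : cut (tail_cut k) f <->
  posfun e K f /\ forall j, (j < k)%N -> f j = 0.
Proof.
have sumE : \sum_(0 <= j < size (nseq k (-1 : rat)))
    f j * ratr (nseq k (-1 : rat))`_j = - \sum_(0 <= j < k) f j.
  rewrite size_nseq -sumrN; apply: eq_big_nat => j /andP[_ jk].
  by rewrite nth_nseq jk rmorphN rmorph1 mulrN1.
split=> [[pf /(_ _ (mem_head _ _))]|[pf f0]].
  rewrite /half_space /= sumE rmorph0 oppr_ge0 => s0; split=> // j jk.
  apply/eqP; rewrite eq_le (proj1 pf) andbT; apply: le_trans s0.
  rewrite big_mkord (bigD1 (Ordinal jk))//= lerDl sumr_ge0// => i _.
  exact: (proj1 pf).
split=> // rc; rewrite inE => /eqP->; rewrite /half_space /= sumE rmorph0.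
by rewrite big_nat big1 ?oppr0// => j /andP[_ jk]; exact: f0.
Qed.

Lemma cut_norm_tail_le k x :
  cut_norm (tail_cut k) x <=
  K ^+ 2 * `|x - \sum_(0 <= j < k) coef e x j *: e j|.
Proof.
apply: cut_norm_le => [|f n /tail_cutP[pf f0]].
  by rewrite mulr_ge0// sqr_ge0.
apply: le_trans (proj2 pf _ n); apply: ler_sum => j _.
have [jk|kj] := ltnP j k; first by rewrite f0// !mul0r.
by rewrite coefB// coef_sum// ltnNge kj/= mul0r subr0.
Qed.

(** Erasing the entries of [f] below [k] leaves a positive functional, which lies in the tail
    cut. *)
Lemma posfun_split f n k x : posfun e K f ->
  \sum_(0 <= j < n) f j * `|coef e x j| <=
  \sum_(0 <= j < k) f j * `|coef e x j| + cut_norm (tail_cut k) x.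
Proof.
move=> pf; pose g j := (k <= j)%:R * f j.
have gf j y : g j * `|coef e y j| <= f j * `|coef e y j|.
  by rewrite ler_wpM2r// ler_piMl ?(proj1 pf)// lern1 leq_b1.
have cg : cut (tail_cut k) g.
  apply/tail_cutP; split; last by move=> j jk; rewrite /g leqNgt jk mul0r.
  split=> [j|y m]; first by rewrite mulr_ge0 ?(proj1 pf).
  by apply: le_trans (proj2 pf y m); apply: ler_sum => j _.
apply: le_trans (lerD (lexx _) (cut_norm_ge n x cg)).
have [nk|kn] := leqP n k.
  rewrite -[leLHS]addr0; apply: lerD.
    rewrite (big_cat_nat (leq0n n) nk)/= lerDl sumr_ge0// => j _.
    exact: posfun_coef_ge0.
  by rewrite sumr_ge0// => j _; rewrite mulr_ge0// mulr_ge0// (proj1 pf).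
rewrite (big_cat_nat (leq0n k) (ltnW kn))/= lerD2l.
rewrite [leRHS](big_cat_nat (leq0n k) (ltnW kn))/=.
rewrite -[leLHS]add0r; apply: lerD.
  by rewrite sumr_ge0// => j _; rewrite mulr_ge0// mulr_ge0// (proj1 pf).
rewrite big_nat [leRHS]big_nat; apply: ler_sum => j /andP[kj _].
by rewrite /g kj mul1r.
Qed.

Lemma cut_tail_small x (eps : R) : 0 < eps ->
  \forall k \near \oo, cut_norm (tail_cut k) x < eps.
Proof.
move=> eps0; have C0 : 0 < K ^+ 2 + 1 by rewrite ltr_wpDl ?sqr_ge0.
have := coef_tail basis_e x (divr_gt0 eps0 C0); apply: filterS => k hk.
apply: le_lt_trans (cut_norm_tail_le k x) _.
have := sqr_ge0 K; move: hk; rewrite ltr_pdivlMr//.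
set t := `|_|; have : 0 <= t by exact: normr_ge0.
nra.
Qed.

End cuts.

(** * Weak cluster points and functionals with prescribed signs *)

Section weak_limits.
Context (R : realType) (X : completeNormedModType R).
Implicit Types (x y : X) (g : X -> R).

Lemma bounded_scalar_dual g (C : R) :
  scalar g -> (forall x, `|g x| <= C * `|x|) -> dual g.
Proof.
move=> glin gC; split=> // x; apply/cvgrPdist_lt => eps eps0.
have C0 : 0 < `|C| + 1 by rewrite ltr_wpDl.
have : \forall y \near x, `|x - y| < eps / (`|C| + 1).
  by apply: cvgr_dist_lt; [exact: cvg_id|exact: divr_gt0].
apply: filterS => y; rewrite ltr_pdivlMr// => hy.
have <- : g (x - y) = g x - g y.
  by rewrite addrC -scaleN1r glin mulN1r addrC.
apply: le_lt_trans (gC _) _.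
by have := ler_norm C; have := normr_ge0 (x - y); nra.
Qed.

Lemma weak_nbhs (xh : X) g (eps : R) : dual g -> 0 < eps ->
  nbhs (xh : weak_space X) [set y | `|g y - g xh| < eps].
Proof.
move=> dg eps0.
have gcont : {for (xh : weak_space X), continuous (g : weak_space X -> R)}.
  have /cvg_sup h : nbhs (xh : weak_space X) --> (xh : weak_space X) by exact: cvg_id.
  apply: cvg_trans (@initial_continuous _ _ g xh).
  apply: cvg_app; exact: (h (exist _ g (mem_set dg))).
have /cvgrPdistC_lt/(_ _ eps0) := gcont; exact.
Qed.

Lemma weakly_compact_cluster (x : nat -> X) (m : nat -> nat) :
  relatively_weakly_compact (range x) ->
  exists xh, forall g, dual g -> forall (eps : R) n, 0 < eps ->
    exists2 i, (n <= i)%N & `|g (x (m i)) - g xh| < eps.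
Proof.
move=> [A xA [cA _]].
pose F : set_system (weak_space X) := (x \o m) @ \oo.
have [xh [_ xhF]] : (A `&` cluster F) !=set0.
  by apply: cA; exists 0%N => // i _; apply: xA; exists (m i).
exists xh => g dg eps n eps0.
have /xhF : F [set y | exists2 i, (n <= i)%N & y = x (m i)].
  by exists n => // i /= ni; exists i.
by move=> /(_ _ (weak_nbhs xh dg eps0)) [_ [[i ni ->] h]]; exists i.
Qed.

End weak_limits.

Section pointwise_cluster.
Context (R : realType) (f : nat -> nat -> R) (b : nat -> R).

Definition pointwise_cluster (h : nat -> R) : Prop :=
  forall l (eps : R) n, 0 < eps ->
    exists2 i, (n <= i)%N & forall j, (j < l)%N -> `|f i j - h j| < eps.

Import ArrowAsProduct.

(** This is Tychonoff's theorem for the product of the segments from [0] to [b j]. *)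
Lemma exists_pointwise_cluster :
  (forall i j, 0 <= f i j <= b j) -> exists h, pointwise_cluster h.
Proof.
move=> fb.
have cA := @tychonoff nat (fun=> R) (fun j => `[0, b j]%classic)
  (fun j => @segment_compact R 0 (b j)).
have [|h [_ hF]] := cA (f @ \oo) _.
  by exists 0%N => // i _ j /=; rewrite in_itv/= fb.
exists h => l eps n eps0.
have : (f @ \oo) [set g | exists2 i, (n <= i)%N & g = f i].
  by exists n => // i /= ni; exists i.
pose N := nbhs (h : forall i : nat, R).
have FN : Filter N by exact: nbhs_filter.
have nh : N [set g | forall j, (j < l)%N -> `|g j - h j| < eps].
  elim: l => [|l IHl]; first by apply: (@nearW _ N) => g j; rewrite ltn0.
  have hl : N [set g | `|g l - h l| < eps].
    have /cvgrPdistC_lt/(_ _ eps0) := @proj_continuous nat (fun=> R) l h; exact.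
  apply: (@filterS2 _ N) IHl hl => g h1 h2 j; rewrite ltnS leq_eqVlt => /predU1P[->//|].
  exact: h1.
by move=> /hF /(_ nh) [_ [[i ni ->] h']]; exists i.
Qed.

(** The inequality is a closed condition on finitely many coordinates, so it passes to cluster
    points. *)
Lemma pointwise_cluster_sum_le h (r : nat -> R) n l c : pointwise_cluster h ->
  (forall i, (n <= i)%N -> \sum_(0 <= j < l) f i j * r j <= c) ->
  \sum_(0 <= j < l) h j * r j <= c.
Proof.
move=> hf fc; apply/ler_addgt0Pr => eps eps0.
set S := \sum_(0 <= j < l) `|r j|.
have S0 : 0 < S + 1 by rewrite ltr_wpDl// sumr_ge0.
have [i ni hi] := hf l _ n (divr_gt0 eps0 S0).
have := fc i ni.
suff : \sum_(0 <= j < l) h j * r j <=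
    \sum_(0 <= j < l) f i j * r j + eps / (S + 1) * S.
  have : eps / (S + 1) * S <= eps.
    rewrite mulrAC ler_pdivrMr// ler_pM2l// lerDl//.
  lra.
rewrite mulr_sumr -big_split/= big_nat [leRHS]big_nat.
apply: ler_sum => j /andP[_ jl].
have : (h j - f i j) * r j <= eps / (S + 1) * `|r j|.
  apply: (le_trans (ler_norm _)); rewrite normrM ler_wpM2r// distrC ltW//.
  exact: hi.
by rewrite mulrBl; lra.
Qed.

End pointwise_cluster.

Section signed_functional.
Context (R : realType) (X : completeNormedModType R) (e : nat -> X) (K : R).
Context (basis_e : schauder_basis e) (K1 : 1 <= K).
Context (uncond_e : unconditional_for (fun x => `|x|) K e).
Implicit Types (x : X) (f s : nat -> R).

Lemma coef_dual j : dual (fun x => coef e x j).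
Proof.
apply: (@bounded_scalar_dual _ _ _ (K / `|e j|)) => [a x y|x].
  by rewrite coefD// coefZ.
have ej0 : 0 < `|e j| by rewrite normr_gt0 (basis_neq0 basis_e).
rewrite mulrAC ler_pdivlMr//; exact: (coef_bound basis_e K1 uncond_e).
Qed.

(** The series of [f j * s j * coef e x j] is Cauchy, since its remainders are dominated by the tail
    seminorms; [g] is its sum, and the case [l = 0] bounds it. *)
Lemma signed_functional f s : posfun e K f -> (forall j, `|s j| <= 1) ->
  exists2 g, dual g & forall x l,
    `|g x - \sum_(0 <= j < l) f j * s j * coef e x j| <=
    cut_norm e K (tail_cut l) x.
Proof.
move=> pf s1.
pose u x n := \sum_(0 <= j < n) f j * s j * coef e x j.
have uabs x l n : (l <= n)%N -> `|u x n - u x l| <= cut_norm e K (tail_cut l) x.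
  move=> ln; have := posfun_split n l x pf.
  rewrite /u !(big_cat_nat (leq0n l) ln)/=.
  rewrite lerD2l addrAC subrr add0r; apply: le_trans.
  apply: (le_trans (ler_norm_sum _ _ _)); apply: ler_sum => j _.
  rewrite !normrM (ger0_norm (proj1 pf j)) ler_wpM2r//.
  by rewrite ler_piMr// (proj1 pf).
have ucvg x : cvgn (u x).
  apply/cauchy_cvgP/cauchy_exP => eps eps0.
  have [l _ /(_ l (leqnn l)) hl] := cut_tail_small K basis_e x eps0.
  exists (u x l); exists l => // n /= ln.
  by rewrite /ball/= distrC; apply: le_lt_trans hl; exact: uabs.
pose g x := limn (u x).
have gu x l : `|g x - u x l| <= cut_norm e K (tail_cut l) x.
  have h : `|u x n - u x l| @[n --> \oo] --> `|g x - u x l|.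
    by apply: cvg_norm; apply: cvgB; [exact: ucvg|exact: cvg_cst].
  apply: (cvgr_to_le h).
  by exists l => // n /= ln; exact: uabs.
exists g => //; apply: (@bounded_scalar_dual _ _ _ (K ^+ 2)) => [a x y|x].
  apply/cvg_lim => //.
  rewrite (_ : u _ = fun n => a * u x n + u y n).
    apply: cvgD; last exact: ucvg.
    by apply: cvgM; [exact: cvg_cst|exact: ucvg].
  apply/funext => n; rewrite /u mulr_sumr -big_split/=.
  by apply: eq_bigr => j _; rewrite coefD// coefZ//; ring.
have := gu x 0%N; rewrite /u big_geq// subr0 => /le_trans; apply.
exact: cut_norm_bound.
Qed.

End signed_functional.

(** * From weak cluster points to norm convergence *)

Section weak_to_tail.
Context (R : realType) (X : completeNormedModType R) (e : nat -> X) (K : R).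
Context (basis_e : schauder_basis e) (K1 : 1 <= K).
Context (uncond_e : unconditional_for (fun x => `|x|) K e).
Context (x : nat -> X) (xh : X).
Implicit Types (f : nat -> R) (D : seq (seq rat * rat)).

Local Notation p := (cut_norm e K).
Local Notation c := (coef e).

Context (coef_cvg : forall j (eps : R), 0 < eps ->
  \forall n \near \oo, `|c (x n) j - c xh j| < eps).
Context (weak_cluster : forall m : nat -> nat, (forall i, (i <= m i)%N) ->
  forall g, dual g -> forall (eps : R) n, 0 < eps ->
  exists2 i, (n <= i)%N & `|g (x (m i)) - g xh| < eps).
Context (additive : forall D (eps : R), 0 < eps ->
  exists N, forall m n, (N <= m)%N -> (N <= n)%N ->
    `|p D (x m) - p D (x n)| < eps /\
    p D (x m) + p D (x n) - p D (x m + x n) < eps).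

(* [lam < liminf p D (x n)], without speaking of the limit. *)
Definition eventually_above D (lam : R) : Prop :=
  exists2 d, 0 < d & exists N, forall n, (N <= n)%N -> lam + d < p D (x n).

(* For [m], [n] large, some positive functional in the cut nearly attains both
   [p D (x m)] and [p D (x n)]. Freezing [m], the functionals large on [x m] form
   a (rational) half-space, and cutting with it costs almost nothing in the
   limit over [n]. *)
Lemma refine_cut D lam eta l m0 : 0 <= lam -> 0 < eta ->
  eventually_above D lam ->
  exists rc m l', [/\ eventually_above (rc :: D) lam, (m0 < m)%N, (l < l')%N,
    (forall f, posfun e K f -> \sum_(0 <= j < l) f j * `|c (x m) j| <=
       \sum_(0 <= j < l) f j * `|c xh j| + eta) &
    p (tail_cut l') (x m) <= eta /\
    forall f, cut e K (rc :: D) f ->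
      lam <= \sum_(0 <= j < l') f j * `|c (x m) j| ].
Proof.
move=> lam0 eta0 [d d0 [N1 HN1]].
have ep0 : 0 < d / 8 by rewrite divr_gt0.
set ep := d / 8 in ep0; have dE : d = 8 * ep by rewrite /ep; field.
have [N2 HN2] := additive D ep0.
pose b j := K ^+ 2 * `|e j|.
have b0 j : 0 <= b j by rewrite mulr_ge0// sqr_ge0.
pose S k := \sum_(0 <= j < k) b j.
have S0 k : 0 < S k + 1 by rewrite ltr_wpDl// sumr_ge0.
(* As positive functionals have entries at most [b j], this closeness of the first [l] coefficients
   changes their sums by at most [eta]. *)
have [N3 HN3] : exists N3, forall m, (N3 <= m)%N -> forall j, (j < l)%N ->
    `|c (x m) j - c xh j| < eta / (S l + 1).
  elim: (l) (eta / (S l + 1)) (divr_gt0 eta0 (S0 l)) => [|k IHk] r r0.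
    by exists 0%N.
  have [N HN] := IHk r r0; have [N' _ HN'] := coef_cvg k r0.
  exists (maxn N N') => m; rewrite geq_max => /andP[Nm N'm] j.
  rewrite ltnS leq_eqVlt => /predU1P[->|]; first exact: HN'.
  exact: HN.
pose m := maxn (maxn N1 N2) (maxn N3 m0.+1).
have mN1 : (N1 <= m)%N by rewrite /m !leq_max leqnn.
have mN2 : (N2 <= m)%N by rewrite /m !leq_max leqnn orbT.
have mN3 : (N3 <= m)%N by rewrite /m !leq_max leqnn !orbT.
have m0m : (m0 < m)%N by rewrite /m !leq_max leqnn !orbT.
have Pm := HN1 m mN1; set P := p D (x m) in Pm.
have tl0 : 0 < Num.min ep eta by rewrite lt_min ep0.
have [N4 _ /(_ (maxn N4 l.+1))/(_ (leq_maxl _ _))] := cut_tail_small K basis_e (x m) tl0.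
set l' := maxn N4 l.+1; rewrite /= lt_min => /andP[tail_ep tail_eta].
have ll' : (l < l')%N by rewrite /l' leq_max ltnSn orbT.
(* Rounding upwards keeps functionals that are large on [x m] inside the half-space, while the
   excess costs at most [ep] on [l'] coordinates. *)
have [r hr] : exists r : nat -> rat, forall j,
    `|c (x m) j| <= ratr (r j) <= `|c (x m) j| + ep / (S l' + 1).
  suff /choice[r hr] : forall j, exists q : rat,
      `|c (x m) j| <= ratr q <= `|c (x m) j| + ep / (S l' + 1) by exists r.
  move=> j; have [|q] := @rat_in_itvoo R `|c (x m) j| (`|c (x m) j| + ep / (S l' + 1)).
    by rewrite ltrDl divr_gt0.
  by rewrite in_itv/= => /andP[h1 h2]; exists q; rewrite !ltW.
(* A near-optimal [f] reaches [P - 2 * ep]: one [ep] is lost to additivity, one to the tail beyond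
   [l']. Conversely, the half-space yields at least [P - 4 * ep] on [x m], which exceeds [lam]
   because [P > lam + 8 * ep]. *)
have [q hq] : exists q : rat, P - 3 * ep <= ratr q <= P - 2 * ep.
  have [|q] := @rat_in_itvoo R (P - 3 * ep) (P - 2 * ep); first by lra.
  by rewrite in_itv/= => /andP[h1 h2]; exists q; rewrite !ltW.
have sumr f : \sum_(0 <= j < size (mkseq r l')) f j * ratr (mkseq r l')`_j =
    \sum_(0 <= j < l') f j * ratr (r j) :> R.
  by rewrite size_mkseq; apply: eq_big_nat => j /andP[_ jl]; rewrite nth_mkseq.
exists (mkseq r l', q), m, l'; split=> //.
- exists (d / 2); first by rewrite divr_gt0.
  exists (maxn N1 N2) => n; rewrite geq_max => /andP[nN1 nN2].
  have [] := HN2 m n mN2 nN2; rewrite -/P ltr_norml => /andP[h1 h2] h3.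
  have h4 := HN1 n nN1.
  (* The two sums that [f] produces are each bounded by their own seminorm, so near-optimality at
     [x m + x n] forces it at both vectors. *)
  have [||f [k [Df hf]]] := @cut_norm_gt _ _ e K D (x m + x n) (P + p D (x n) - ep).
  - lra.
  - lra.
  have pf := proj1 Df.
  have hk : P + p D (x n) - ep < \sum_(0 <= j < k) f j * `|c (x m) j| +
      \sum_(0 <= j < k) f j * `|c (x n) j|.
    apply: (lt_le_trans hf); rewrite -big_split/=; apply: ler_sum => j _.
    by rewrite -mulrDr ler_wpM2l ?(proj1 pf)// coefD// ler_normD.
  have hm := cut_norm_ge k (x m) Df; have hn := cut_norm_ge k (x n) Df.
  have hs := posfun_split k l' (x m) pf.
  rewrite -/P in hm.
  have Df' : cut e K ((mkseq r l', q) :: D) f.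
    split=> // rc; rewrite inE => /predU1P[->|]; last exact: (proj2 Df).
    rewrite /half_space /= sumr; have /andP[_ hq2] := hq.
    apply: (le_trans hq2).
    have : \sum_(0 <= j < l') f j * `|c (x m) j| <= \sum_(0 <= j < l') f j * ratr (r j).
      apply: ler_sum => j _; rewrite ler_wpM2l ?(proj1 pf)//.
      by have /andP[] := hr j.
    by move: hk hm hn hs tail_ep; lra.
  have := cut_norm_ge k (x n) Df'.
  by move: hk hm hn; lra.
- move=> f pf; have hS : eta / (S l + 1) * S l <= eta.
    by rewrite mulrAC ler_pdivrMr// ler_pM2l// lerDl.
  apply: le_trans (lerD (lexx _) hS); rewrite mulr_sumr -big_split/=.
  rewrite big_nat [leRHS]big_nat; apply: ler_sum => j /andP[_ jl].
  have fb := posfun_le basis_e j pf; rewrite -/(b j) in fb.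
  have f0 := proj1 pf j; have := ltW (HN3 m mN3 j jl).
  set w := eta / _ => h; have w0 : 0 <= w by rewrite /w divr_ge0 ?ltW.
  have h2 : `|c (x m) j| <= `|c xh j| + w.
    have := ler_normD (c (x m) j - c xh j) (c xh j); rewrite subrK; lra.
  apply: (le_trans (ler_wpM2l f0 h2)); rewrite mulrDr lerD2l mulrC.
  exact: ler_wpM2l.
- split; first exact: ltW.
  move=> f [pf Df].
  have /andP[hq1 _] := hq.
  have := Df _ (mem_head _ _); rewrite /half_space /= sumr => h.
  have hS : ep / (S l' + 1) * S l' <= ep.
    by rewrite mulrAC ler_pdivrMr// ler_pM2l// lerDl.
  have : \sum_(0 <= j < l') f j * ratr (r j) <=
      \sum_(0 <= j < l') f j * `|c (x m) j| + ep / (S l' + 1) * S l'.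
    rewrite mulr_sumr -big_split/=; apply: ler_sum => j _.
    have fb := posfun_le basis_e j pf; rewrite -/(b j) in fb.
    have f0 := proj1 pf j; have /andP[_ hrj] := hr j.
    set w := ep / _ in hrj *; have w0 : 0 <= w by rewrite /w divr_ge0 ?ltW.
    apply: (le_trans (ler_wpM2l f0 hrj)); rewrite mulrDr lerD2l mulrC.
    exact: ler_wpM2l.
  by move: hq1 h hS Pm; lra.
Qed.

(** The blocks are disjoint because [l] increases, so an index obeys at most one sign requirement;
    indices in no block receive [0]. *)
Lemma block_signs (l m : nat -> nat) : (forall i, (l i < l i.+1)%N) ->
  exists s : nat -> R, (forall j, `|s j| <= 1) /\
    forall i j, (l i <= j < l i.+1)%N -> s j * c (x (m i)) j = `|c (x (m i)) j|.
Proof.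
move=> ll.
have lmono i k : (i <= k)%N -> (l i <= l k)%N.
  apply: (@homo_leq _ l (fun a b => a <= b)%N) => //; first exact: leq_trans.
  by move=> n; exact: ltnW.
suff /choice[s hs] : forall j, exists t : R, `|t| <= 1 /\
    forall i, (l i <= j < l i.+1)%N -> t * c (x (m i)) j = `|c (x (m i)) j|.
  by exists s; split=> [j|i j]; [case: (hs j)|case: (hs j) => _; exact].
move=> j; have [[i ij]|ni] := pselect (exists i, (l i <= j < l i.+1)%N); last first.
  by exists 0; split=> [|i ij]; [rewrite normr0|exfalso; apply: ni; exists i].
exists (Num.sg (c (x (m i)) j)); split.
  by rewrite normr_sg lern1 leq_b1.
move=> k kj; suff -> : k = i by rewrite -normrEsg.
move: ij kj => /andP[i1 i2] /andP[k1 k2].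
apply/eqP; rewrite eqn_leq; apply/andP; split; rewrite leqNgt; apply/negP => /lmono.
  by move=> h; have := leq_trans (leq_trans i2 h) k1; rewrite ltnn.
by move=> h; have := leq_trans (leq_trans k2 h) i1; rewrite ltnn.
Qed.

(* Iterating [refine_cut] and passing to a cluster point yields one positive
   functional [f] with [\sum_j f j * |c (x (m i)) j| >= lam] for all [i], the
   mass sitting essentially on disjoint blocks. Choosing signs blockwise turns
   [f] into a continuous functional bounded below on the subsequence, to be
   compared with its value at the weak cluster point [xh]. *)
Lemma eventually_above_le D lam : 0 <= lam -> eventually_above D lam ->
  lam <= 3 * p D xh.
Proof.
move=> lam0 aboveD; apply/ler_addgt0Pr => eps eps0.
(* Five errors of size [eta] occur: replacing the head of [x (m i)] by that of [xh] (twice), the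
   tail of [x (m i)], the weak approximation, and the tail of [xh]. The head counted twice and the
   value of [g] at [xh] give the factor [3]. *)
have [eta eta0 epsE] : exists2 eta : R, 0 < eta & eps = 5 * eta.
  by exists (eps / 5); [rewrite divr_gt0|field].
pose T := {s : seq (seq rat * rat) * nat * nat | eventually_above s.1.1 lam}.
pose Dof (s : T) := (sval s).1.1; pose lof (s : T) := (sval s).1.2.
pose mof (s : T) := (sval s).2.
pose refines (s t : T) := [/\ exists rc, Dof t = rc :: Dof s,
  (mof s < mof t)%N, (lof s < lof t)%N,
  (forall f, posfun e K f ->
     \sum_(0 <= j < lof s) f j * `|c (x (mof t)) j| <=
     \sum_(0 <= j < lof s) f j * `|c xh j| + eta) &
  p (tail_cut (lof t)) (x (mof t)) <= eta /\
  forall f, cut e K (Dof t) f ->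
    lam <= \sum_(0 <= j < lof t) f j * `|c (x (mof t)) j| ].
have step (s : T) : {t : T | refines s t}.
  apply: cid; case: s => -[[D' l] m] aD'.
  have [rc [m' [l' [h1 h2 h3 h4 h5]]]] := @refine_cut D' lam eta l m lam0 eta0 aD'.
  by exists (exist _ (rc :: D', l', m') h1); split=> //; exists rc.
have [s [s0 sR]] := dependent_choice step (exist _ (D, 0%N, 0%N) aboveD).
(* An empty cut would have seminorm [0], which is not above [lam >= 0]. *)
have nonempty i : exists f, cut e K (Dof (s i)) f.
  have [d d0 [N /(_ N (leqnn N)) hN]] := svalP (s i).
  have [|f [n [Df _]]] := @cut_norm_gt _ _ e K (Dof (s i)) (x N) lam lam0.
    by apply: lt_trans hN; rewrite ltrDl.
  by exists f.
have [F FD] := choice nonempty.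
have cut_anti i n f : cut e K (Dof (s (n + i)%N)) f -> cut e K (Dof (s i)) f.
  elim: n => [//|n IHn] h; apply: IHn.
  have [[rc DE] _ _ _ _] := sR (n + i)%N; rewrite addSn DE in h.
  by split=> [|rc' rcD]; [exact: (proj1 h)|apply: (proj2 h); rewrite inE rcD orbT].
have FDle i k : (i <= k)%N -> cut e K (Dof (s i)) (F k).
  by move=> ik; apply: (@cut_anti i (k - i)%N); rewrite subnK.
(* The cuts decrease, so [F k] meets the constraints of all stages up to [k]. Each constraint
   involves finitely many coordinates and survives in the cluster point [f]. *)
have [|f Ff] := @exists_pointwise_cluster _ F (fun j => K ^+ 2 * `|e j|).
  by move=> i j; rewrite (proj1 (proj1 (FD i))) (posfun_le basis_e _ (proj1 (FD i))).
have fle := pointwise_cluster_sum_le Ff.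
have fge (r : nat -> R) n l a :
    (forall i, (n <= i)%N -> a <= \sum_(0 <= j < l) F i j * r j) ->
    a <= \sum_(0 <= j < l) f j * r j.
  move=> h; rewrite -lerN2 -sumrN.
  under eq_bigr do rewrite -mulrN.
  apply: (fle _ n) => i ni; have := h i ni; rewrite -lerN2 -sumrN.
  by under eq_bigr do rewrite -mulrN.
have pf : posfun e K f.
  split=> [j|y n].
    apply/ler_addgt0Pr => d d0; have [i _ /(_ j (ltnSn j))] := Ff j.+1 d 0%N d0.
    have := proj1 (proj1 (FD i)) j; rewrite ltr_norml => h /andP[h1 h2]; lra.
  by apply: (fle _ 0%N) => i _; exact: (proj2 (proj1 (FD i))).
have Df : cut e K D f.
  split=> // rc rcD; apply: (fge _ 0%N) => i _.
  have := FDle 0%N i (leq0n i); rewrite /Dof s0 /= => -[_]; exact.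
have flam i : lam <= \sum_(0 <= j < lof (s i.+1)) f j * `|c (x (mof (s i.+1))) j|.
  have [_ _ _ _ [_ h]] := sR i.
  by apply: (fge _ i.+1) => k ik; apply: h; exact: FDle.
have lincr i : (lof (s i) < lof (s i.+1))%N by have [] := sR i.
have mge i : (i <= mof (s i.+1))%N.
  elim: i => [//|i IHi]; apply: (leq_ltn_trans IHi).
  by have [] := sR i.+1.
have [sg [sg1 sgE]] := block_signs (fun i => mof (s i.+1)) lincr.
have [g dg gE] := signed_functional basis_e pf sg1.
have [i _] := weak_cluster mge dg 0 eta0.
set y := x _ => gy.
have [_ _ _ /(_ f pf) head [tail _]] := sR i; rewrite -/y in head tail.
have head_xh := cut_norm_ge (lof (s i)) xh Df.
have := flam i; rewrite -/y (big_cat_nat (leq0n _) (ltnW (lincr i)))/=.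
have := le_trans (gE y _) tail.
rewrite (big_cat_nat (leq0n _) (ltnW (lincr i)))/=.
have -> : \sum_(lof (s i) <= j < lof (s i.+1)) f j * sg j * c y j =
    \sum_(lof (s i) <= j < lof (s i.+1)) f j * `|c y j|.
  by apply: eq_big_nat => j lj; rewrite -mulrA sgE.
have : `|\sum_(0 <= j < lof (s i)) f j * sg j * c y j| <=
    \sum_(0 <= j < lof (s i)) f j * `|c y j|.
  apply: (le_trans (ler_norm_sum _ _ _)); apply: ler_sum => j _.
  by rewrite !normrM (ger0_norm (proj1 pf j)) ler_wpM2r// ler_piMr// (proj1 pf).
have [l _ /(_ l (leqnn l)) hl] := cut_tail_small K basis_e xh eta0.
have : `|\sum_(0 <= j < l) f j * sg j * c xh j| <= p D xh.
  apply: le_trans (cut_norm_ge l xh Df).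
  apply: (le_trans (ler_norm_sum _ _ _)); apply: ler_sum => j _.
  by rewrite !normrM (ger0_norm (proj1 pf j)) ler_wpM2r// ler_piMr// (proj1 pf).
have := gE xh l; move: gy head head_xh hl; rewrite /= epsE.
rewrite !ler_norml !ltr_norml => /andP[? ?] ? ? ? /andP[? ?] /andP[? ?].
move=> /andP[? ?] /andP[? ?].
lra.
Qed.

(** The values eventually vary by less than [eps / 4], so one late value above the bound would put
    [3 * p D xh + eps / 4] eventually below all of them, against [eventually_above_le]. *)
Lemma cut_norm_limsup D (eps : R) : 0 < eps ->
  exists N, forall n, (N <= n)%N -> p D (x n) <= 3 * p D xh + eps.
Proof.
move=> eps0; have ep0 : 0 < eps / 4 by rewrite divr_gt0.
have [N HN] := additive D ep0.
have near n : (N <= n)%N -> `|p D (x N) - p D (x n)| < eps / 4.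
  by move=> Nn; case: (HN N n (leqnn N) Nn).
have [h|h] := leP (p D (x N)) (3 * p D xh + 3 * (eps / 4)).
  by exists N => n /near; rewrite ltr_norml => /andP[]; lra.
have p0 := cut_norm_ge0 e K D xh.
have : eventually_above D (3 * p D xh + eps / 4).
  exists (eps / 4) => //; exists N => n /near; rewrite ltr_norml => /andP[]; lra.
move=> /eventually_above_le; lra.
Qed.

Lemma cvg_weak_cluster : x @ \oo --> xh.
Proof.
apply/cvgrPdistC_lt => eps eps0.
have ep0 : 0 < eps / 8 by rewrite divr_gt0.
have [k _ /(_ k (leqnn k)) hk] := cut_tail_small K basis_e xh ep0.
have [N HN] := cut_norm_limsup (tail_cut k) ep0.
pose b j := K ^+ 2 * `|e j|.
have b0 j : 0 <= b j by rewrite mulr_ge0// sqr_ge0.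
pose S := \sum_(0 <= j < k) b j.
have S0 : 0 < S + 1 by rewrite ltr_wpDl// sumr_ge0.
have head : \forall n \near \oo, forall j, (j < k)%N ->
    `|c (x n) j - c xh j| < eps / 8 / (S + 1).
  elim: (k) => [|i IHi]; first by apply: nearW => n j; rewrite ltn0.
  apply: filterS2 IHi (coef_cvg i (divr_gt0 ep0 S0)) => n h1 h2 j.
  by rewrite ltnS leq_eqVlt => /predU1P[->//|]; exact: h1.
have tail : \forall n \near \oo, p (tail_cut k) (x n) <= 3 * p (tail_cut k) xh + eps / 8.
  by exists N.
apply: filterS2 head tail => n h1 h2.
apply: (le_lt_trans (cut_norm_nil_ge basis_e K1 uncond_e _)).
(* The head costs one unit [eps / 8], the tail of [x n] costs [3 + 1], and the tail of [xh] one. *)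
apply: (@le_lt_trans _ _ (6 * (eps / 8))); last by lra.
apply: cut_norm_le => [|f l [pf _]]; first by lra.
apply: (le_trans (posfun_split l k _ pf)).
have := cut_normD K basis_e (tail_cut k) (x n) (- xh).
rewrite -scaleN1r cut_normZ// normrN1 mul1r scaleN1r => h3.
suff : \sum_(0 <= j < k) f j * `|c (x n - xh) j| <= eps / 8 by move: h2 hk h3; lra.
have hS : eps / 8 / (S + 1) * S <= eps / 8.
  by rewrite mulrAC ler_pdivrMr// ler_pM2l// lerDl.
apply: le_trans hS; rewrite mulr_sumr big_nat [leRHS]big_nat.
apply: ler_sum => j /andP[_ jk]; rewrite coefB// mulrC.
apply: ler_pM => //; first exact: (proj1 pf).
  by rewrite ltW// h1.
exact: posfun_le.
Qed.

End weak_to_tail.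

(** * The renorming *)

Lemma equivalent_norm_cvg (R : realType) (X : completeNormedModType R)
    (N : X -> R) (u : nat -> X) (x : X) :
  equivalent_norm N -> norm_cvg_to N u x <-> u @ \oo --> x.
Proof.
move=> [_ [c [C [c0 C0 NcC]]]].
have N0 y : 0 <= N y.
  by apply: le_trans (proj1 (NcC y)); rewrite mulr_ge0// ltW.
split.
  move=> /cvgr0Pnorm_lt h; apply/cvgrPdistC_lt => eps eps0.
  apply: filterS (h _ (mulr_gt0 c0 eps0)) => n.
  rewrite ger0_norm// => hn; rewrite -(ltr_pM2l c0).
  exact: le_lt_trans (proj1 (NcC _)) hn.
move=> /cvgrPdistC_lt h; apply/cvgr0Pnorm_lt => eps eps0.
apply: filterS (h _ (divr_gt0 eps0 C0)) => n.
rewrite ltr_pdivlMr// mulrC ger0_norm//; exact: le_lt_trans (proj2 (NcC _)).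
Qed.

Section renorming.
Context (R : realType) (X : completeNormedModType R) (e : nat -> X) (K : R).
Context (basis_e : schauder_basis e) (K1 : 1 <= K).
Context (uncond_e : unconditional_for (fun x => `|x|) K e).
Implicit Types (x y : X) (D : seq (seq rat * rat)).

(** The factor [|e j|] bounds the coordinate seminorms uniformly by [K * |x|]; indices that encode
    nothing contribute the zero seminorm. *)
Definition seminorms (i : nat) x : R :=
  match @unpickle (nat + seq (seq rat * rat))%type i with
  | Some (inl j) => `|coef e x j| * `|e j|
  | Some (inr D) => cut_norm e K D x
  | None => 0
  end.

Definition renorm : X -> R := l2norm seminorms.

Let q_ge0 i x : 0 <= seminorms i x.
Proof.
rewrite /seminorms; case: unpickle => [[j|D]|]//; exact: cut_norm_ge0.
Qed.

Let qD i x y : seminorms i (x + y) <= seminorms i x + seminorms i y.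
Proof.
rewrite /seminorms; case: unpickle => [[j|D]|]; last by rewrite addr0.
  by rewrite -mulrDl ler_wpM2r// coefD// ler_normD.
exact: cut_normD.
Qed.

Let qZ i (a : R) x : seminorms i (a *: x) = `|a| * seminorms i x.
Proof.
rewrite /seminorms; case: unpickle => [[j|D]|]; last by rewrite mulr0.
  by rewrite coefZ// normrM mulrA.
exact: cut_normZ.
Qed.

Let qB i x : seminorms i x <= K ^+ 2 * `|x|.
Proof.
rewrite /seminorms; case: unpickle => [[j|D]|].
- apply: (le_trans (coef_bound basis_e K1 uncond_e x j)).
  by rewrite ler_wpM2r// expr2 ler_peMr// (le_trans ler01).
- exact: cut_norm_bound.
- by rewrite mulr_ge0// sqr_ge0.
Qed.

Lemma renorm_equivalent : equivalent_norm renorm.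
Proof.
pose c : R := Num.sqrt (2^-1 ^+ (@pickle (nat + seq (seq rat * rat))%type (inr [::])).+1).
have c0 : 0 < c by rewrite sqrtr_gt0 exprn_gt0// invr_gt0.
have Nc x : c * `|x| <= renorm x.
  have := l2norm_ge q_ge0 qB (@pickle (nat + seq (seq rat * rat))%type (inr [::])) x.
  apply: le_trans; rewrite -/c ler_pM2l// /seminorms pickleK.
  exact: (cut_norm_nil_ge basis_e K1 uncond_e).
split.
  split=> [x y|a x|x x0]; first exact: (l2normD q_ge0 qD qB).
    exact: (l2normZ q_ge0 qZ qB).
  apply/eqP; rewrite -normr_eq0 eq_le normr_ge0 andbT.
  by have := Nc x; rewrite x0 pmulr_rle0.
exists c, (K ^+ 2); split=> // [|x]; first by rewrite exprn_gt0// (lt_le_trans ltr01).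
by split; [exact: Nc|exact: (l2norm_le_bound q_ge0 qB)].
Qed.

(** Every summand depends only on the absolute values of the coefficients. The signed series
    converges by unconditionality in the original norm. *)
Lemma renorm_unconditional : unconditional_for renorm 1 e.
Proof.
move=> a s x /(equivalent_norm_cvg _ _ renorm_equivalent) xa.
have [y ay _] := uncond_e s (proj2 (norm_cvg_toP _ _) xa).
have ya := proj1 (norm_cvg_toP _ _) ay.
exists y; first exact/(equivalent_norm_cvg _ _ renorm_equivalent).
have xy j : `|coef e y j| = `|coef e x j|.
  by rewrite (coef_unique basis_e ya) (coef_unique basis_e xa) normrM normr_sign mul1r.
rewrite mul1r /renorm (_ : l2norm _ y = l2norm seminorms x)//.
rewrite /l2norm; congr (Num.sqrt (sup _)); apply: eq_imagel => n _.
apply: eq_bigr => i _; congr (_ * _ ^+ 2); rewrite /seminorms.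
case: unpickle => [[j|D]|]//; first by rewrite xy.
exact: cut_norm_abs.
Qed.

Lemma renorm_cvg (x : nat -> X) :
  relatively_weakly_compact (range x) ->
  (renorm (x mn.1 + x mn.2) ^+ 2
     - 2 * (renorm (x mn.1) ^+ 2 + renorm (x mn.2) ^+ 2))
    @[mn --> filter_prod \oo \oo] --> (0 : R) ->
  norm_cvg renorm x.
Proof.
move=> xcpt /cvgr0Pnorm_lt defect0.
have defect i (eps : R) : 0 < eps -> exists M, forall m n, (M <= m)%N -> (M <= n)%N ->
    2 * (seminorms i (x m) ^+ 2 + seminorms i (x n) ^+ 2)
      - seminorms i (x m + x n) ^+ 2 < eps.
  move=> eps0; have w0 : 0 < 2^-1 ^+ i.+1 :> R by rewrite exprn_gt0// invr_gt0.
  have [[P Q] [[M1 _ PM1] [M2 _ QM2]] PQ] := defect0 _ (mulr_gt0 w0 eps0).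
  exists (maxn M1 M2) => m n; rewrite !geq_max => /andP[m1 m2] /andP[n1 n2].
  rewrite -(ltr_pM2l w0).
  apply: (le_lt_trans (l2norm_defect q_ge0 qD qB i (x m) (x n))).
  have := PQ (m, n) (conj (PM1 m m1) (QM2 n n2)); apply: le_lt_trans.
  by rewrite /= -normrN opprB ler_norm.
have coef_cauchy j (eps : R) : 0 < eps -> exists M, forall m n,
    (M <= m)%N -> (M <= n)%N -> `|coef e (x m) j - coef e (x n) j| < eps.
  move=> eps0; have ej0 : 0 < `|e j| by rewrite normr_gt0 (basis_neq0 basis_e).
  have [M HM] := defect (@pickle (nat + seq (seq rat * rat))%type (inl j))
    ((eps * `|e j|) ^+ 2) (exprn_gt0 _ (mulr_gt0 eps0 ej0)).
  exists M => m n Mm Mn; have := HM m n Mm Mn; rewrite /seminorms pickleK.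
  rewrite coefD// !exprMn !real_normK ?num_real// -!mulrDl mulrA -mulrBl.
  rewrite ltr_pM2r ?exprn_gt0// => h.
  rewrite -(ltr_pXn2r (n := 2)) ?nnegrE ?(ltW eps0)// real_normK ?num_real//.
  by apply: le_lt_trans h; lra.
have additive D (eps : R) : 0 < eps ->
    exists M, forall m n, (M <= m)%N -> (M <= n)%N ->
      `|cut_norm e K D (x m) - cut_norm e K D (x n)| < eps /\
      cut_norm e K D (x m) + cut_norm e K D (x n) - cut_norm e K D (x m + x n) < eps.
  move=> eps0.
  have [M HM] := defect (@pickle (nat + seq (seq rat * rat))%type (inr D))
    (eps ^+ 2) (exprn_gt0 _ eps0).
  exists M => m n Mm Mn; have := HM m n Mm Mn; rewrite /seminorms pickleK.
  have := cut_normD K basis_e D (x m) (x n); have := cut_norm_ge0 e K D (x m + x n).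
  move: (cut_norm e K D (x m + x n)) (cut_norm e K D (x m)) (cut_norm e K D (x n)).
  move=> s a b s0 sab h; have ltr_sqr t : t ^+ 2 < eps ^+ 2 -> `|t| < eps.
    move=> ht; rewrite -(ltr_pXn2r (n := 2)) ?nnegrE ?(ltW eps0)//.
    by rewrite real_normK ?num_real.
  (* The defect equals [(a - b) ^+ 2 + (a + b - s) ^+ 2 + 2 * s * (a + b - s)], so it dominates both
     squares. *)
  have h1 : 0 <= s * (a + b - s) by rewrite mulr_ge0// subr_ge0.
  have h2 := sqr_ge0 (a - b).
  split; first by apply: ltr_sqr; nra.
  by apply: le_lt_trans (ler_norm _) _; apply: ltr_sqr; lra.
have [xh xhP] := weakly_compact_cluster (fun i => i) xcpt.
have coef_cvg j (eps : R) : 0 < eps ->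
    \forall n \near \oo, `|coef e (x n) j - coef e xh j| < eps.
  move=> eps0; have ep0 : 0 < eps / 2 by rewrite divr_gt0.
  have [M HM] := coef_cauchy j _ ep0.
  have [i Mi hi] := xhP _ (coef_dual basis_e K1 uncond_e j) _ M ep0.
  exists M => // n /= Mn; have := HM n i Mn Mi; have := ler_normD
    (coef e (x n) j - coef e (x i) j) (coef e (x i) j - coef e xh j).
  by rewrite addrA subrK; move: hi => /=; lra.
have weak_cluster (m : nat -> nat) : (forall i, (i <= m i)%N) ->
    forall g, dual g -> forall (eps : R) n, 0 < eps ->
    exists2 i, (n <= i)%N & `|g (x (m i)) - g xh| < eps.
  (* A cluster point along [m] has the limits of the coefficients as its own, hence equals [xh]. *)
  move=> mi; have [xh' xh'P] := weakly_compact_cluster m xcpt.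
  suff -> : xh = xh' by [].
  apply: (coef_inj basis_e) => j; apply/eqP; rewrite -subr_eq0 -normr_eq0.
  rewrite eq_le normr_ge0 andbT; apply/ler_addgt0Pr => eps eps0; rewrite add0r.
  have ep0 : 0 < eps / 2 by rewrite divr_gt0.
  have [M _ HM] := coef_cvg j _ ep0.
  have [i Mi hi] := xh'P _ (coef_dual basis_e K1 uncond_e j) _ M ep0.
  have := HM (m i) (leq_trans Mi (mi i)); rewrite /= distrC => h.
  have := ler_normD (coef e xh j - coef e (x (m i)) j)
    (coef e (x (m i)) j - coef e xh' j).
  by rewrite addrA subrK; move: hi h; lra.
exists xh; apply/(equivalent_norm_cvg _ _ renorm_equivalent).
exact: (cvg_weak_cluster basis_e K1 uncond_e coef_cvg weak_cluster additive).
Qed.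

End renorming.

(** * Bounded sequences in reflexive spaces *)

Section reflexive.
Context (R : realType) (X : completeNormedModType R).
Implicit Types (x y : X) (f g : X -> R).

(** Continuity at [0] bounds [f] by [1] on a ball of radius [d], into which the unit ball is scaled
    by [d / 2]. *)
Lemma dual_norm_has_ubound f : dual f ->
  has_ubound [set `|f x| | x in [set x | `|x| <= 1]].
Proof.
move=> [flin fcont].
have f0 : f 0 = 0 by have := flin (-1) 0 0; rewrite scaler0 addr0; lra.
have fZ a y : f (a *: y) = a * f y by have := flin a y 0; rewrite f0 !addr0.
have /cvgrPdist_lt/(_ _ ltr01) := fcont 0.
rewrite f0 => /nbhs_ballP[d /= d0 hd].
exists (2 / d) => _ [y /= y1 <-].
have : `|0 - f ((d / 2) *: y)| < 1.
  apply: hd; rewrite -ball_normE /= sub0r normrN normrZ gtr0_norm ?divr_gt0//.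
  have := normr_ge0 y; nra.
rewrite sub0r normrN fZ normrM gtr0_norm ?divr_gt0// => h.
by rewrite ler_pdivlMr// ltW//; move: h; lra.
Qed.

Lemma dual_norm_ge0 f : dual f -> 0 <= dual_norm f.
Proof.
move=> df; apply: le_trans (normr_ge0 (f 0)) _.
by apply: ub_le_sup; [exact: dual_norm_has_ubound|exists 0; rewrite //= normr0].
Qed.

Lemma dual_norm_bound f x : dual f -> `|f x| <= dual_norm f * `|x|.
Proof.
move=> df; have [flin _] := df.
have f0 : f 0 = 0 by have := flin (-1) 0 0; rewrite scaler0 addr0; lra.
have fZ a y : f (a *: y) = a * f y by have := flin a y 0; rewrite f0 !addr0.
have [->|x0] := eqVneq x 0; first by rewrite f0 !normr0 mulr0.
have nx0 : 0 < `|x| by rewrite normr_gt0.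
rewrite -ler_pdivrMr// mulrC -[X in X * _]ger0_norm ?invr_ge0// -normrM -fZ.
apply: ub_le_sup; first exact: dual_norm_has_ubound.
exists (`|x|^-1 *: x) => //=.
by rewrite normrZ ger0_norm ?invr_ge0// mulVf ?gt_eqF.
Qed.

(* Banach-Alaoglu: along an ultrafilter of bounded vectors every functional
   converges, and the limits form an element of the bidual. *)
Lemma reflexive_bounded_weakly_compact (u : nat -> X) (C : R) :
  reflexive_space X -> (forall n, `|u n| <= C) ->
  relatively_weakly_compact (range u).
Proof.
move=> refl uC.
pose A : set (weak_space X) := [set x | forall f, dual f -> `|f x| <= C * dual_norm f].
exists A.
  move=> _ [n _ <-] f df; apply: (le_trans (dual_norm_bound _ df)).
  by rewrite mulrC ler_wpM2r// dual_norm_ge0.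
split; last first.
  move=> x clx f df; apply/ler_addgt0Pr => eps eps0.
  have [y [Ay /= hy]] := clx _ (weak_nbhs x df eps0).
  have := Ay _ df; have := ler_normD (f x - f y) (f y).
  by rewrite subrK distrC; move: hy; lra.
rewrite compact_ultra => F UF FA.
have FP : ProperFilter F by exact: ultra_proper.
have cvgF f : dual f -> cvg (f @ F).
  move=> df; have fA : F (f @^-1` `[- (C * dual_norm f), C * dual_norm f]%classic).
    apply: (@filterS _ F _ _ _ _ FA) => x /(_ f df) h.
    by rewrite /= in_itv/= -ler_norml.
  (* The bounded values of [f] cluster at some [l], and along an ultrafilter a cluster point is a
     limit. *)
  have [l [_ hl]] := @segment_compact R _ _ (f @ F) _ fA.
  apply/cvg_ex; exists l => B lB.
  have [//|FB] := in_ultra_setVsetC (f @^-1` B) UF.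
  by have [r []] := hl (~` B) B FB lB.
pose G f := lim (f @ F).
have GF f : dual f -> f x @[x --> F] --> G f by move=> /cvgF.
have [|x Gx] := refl G.
  split=> [a f g df dg|].
    apply/cvg_lim => //; apply: cvgD; last exact: GF.
    by apply: cvgM; [exact: cvg_cst|exact: GF].
  exists C => f df.
  have h : `|f x| @[x --> F] --> `|G f| by apply: cvg_norm; exact: GF.
  by apply: (cvgr_to_le h); apply: filterS FA => x; exact.
exists x; split.
  move=> f df; rewrite -Gx//.
  have h : `|f x| @[x --> F] --> `|G f| by apply: cvg_norm; exact: GF.
  by apply: (cvgr_to_le h); apply: filterS FA => y; exact.
apply/cvg_sup => -[f fd] B [_ [[U oU <-] Ufx UB]].
have df : dual f by exact: set_mem.
have /(GF f df) FU : nbhs (G f) U by rewrite Gx//; exact: open_nbhs_nbhs.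
exact: filterS UB FU.
Qed.

End reflexive.

(** On the unit ball the parallelogram defect lies between [0] and [4 - N (u m + u n) ^+ 2], which
    tends to [0]; reflexivity supplies the weak compactness. *)
Lemma two_rotund_of_defect (R : realType) (X : completeNormedModType R)
    (N : X -> R) :
  equivalent_norm N -> reflexive_space X ->
  (forall x : nat -> X,
     relatively_weakly_compact (range x) ->
     (N (x mn.1 + x mn.2) ^+ 2 - 2 * (N (x mn.1) ^+ 2 + N (x mn.2) ^+ 2))
       @[mn --> filter_prod \oo \oo] --> (0 : R) ->
     norm_cvg N x) ->
  two_rotund N.
Proof.
move=> [[ND _ _] [c [C [c0 _ NcC]]]] refl Ncvg u u1 u2.
have N0 x : 0 <= N x.
  by apply: le_trans (proj1 (NcC x)); rewrite mulr_ge0// ltW.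
apply: Ncvg.
  apply: (reflexive_bounded_weakly_compact (C := c^-1) refl) => n.
  rewrite -[c^-1]mulr1 ler_pdivlMl//.
  exact: le_trans (proj1 (NcC _)) (u1 n).
have defect_cvg : 4 - N (u mn.1 + u mn.2) ^+ 2
    @[mn --> filter_prod \oo \oo] --> (0 : R).
  rewrite (_ : 0 = 4 - 2 * 2); last by ring.
  by apply: cvgB; [exact: cvg_cst|exact: cvgM].
apply/cvgr0Pnorm_lt => eps eps0.
have /cvgr0Pnorm_lt/(_ _ eps0) := defect_cvg.
apply: filterS => -[m n] /=; apply: le_lt_trans.
have := ND (u m) (u n); have := N0 (u m + u n).
have := u1 m; have := u1 n; have := N0 (u m); have := N0 (u n).
move: (N (u m + u n)) (N (u m)) (N (u n)) => s a b b0 a0 b1 a1 s0 sab.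
have h1 : s ^+ 2 <= (a + b) ^+ 2 by rewrite lerXn2r ?nnegrE ?addr_ge0.
have h2 := sqr_ge0 (a - b).
have a2 : a ^+ 2 <= 1 by rewrite exprn_ile1.
have b2 : b ^+ 2 <= 1 by rewrite exprn_ile1.
rewrite ler0_norm; last by lra.
by apply: le_trans (ler_norm _); lra.
Qed.

Theorem theorem3p1 (R : realType) (X : completeNormedModType R) (e : nat -> X) :
  unconditional_basis e ->
  exists N : X -> R,
    [/\ equivalent_norm N,
        unconditional_for N 1 e,
        forall x : nat -> X,
          relatively_weakly_compact (range x) ->
          (N (x mn.1 + x mn.2) ^+ 2 - 2 * (N (x mn.1) ^+ 2 + N (x mn.2) ^+ 2))
            @[mn --> filter_prod \oo \oo] --> (0 : R) ->
          norm_cvg N x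
      & reflexive_space X -> two_rotund N /\ unconditional_for N 1 e].
Proof.
move=> [basis_e [K K1 uncond_e]]; exists (renorm e K).
have equivN := renorm_equivalent basis_e K1 uncond_e.
have uncondN := renorm_unconditional basis_e K1 uncond_e.
have cvgN := renorm_cvg basis_e K1 uncond_e.
by split=> // refl; split=> //; exact: two_rotund_of_defect.
Qed.
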